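(* For every integer $n\geq 1$, the following identities hold in $\mathbb{Z}[x]$: $$x\bigl(F_{2n+1}(x)-F_{2n-1}(x)\bigr) = T_{2n+1}(x)-T_{2n-1}(x)-(3x^2-4)\sum_{k=0}^{n-1}F_{2k+1}(x)T_{2(n-k)-1}(x),$$ $$2xF_{2n+1}(x) = U_{2n+1}(x)-U_{2n-1}(x)-(3x^2-4)\sum_{k=0}^{n-1}F_{2k+1}(x)U_{2(n-k)-1}(x),$$ $$F_{2n}(x)-(2x^2-1)F_{2n-2}(x) = xT_{2n-2}(x)-(3x^2-4)\sum_{k=1}^{n-1}F_{2k}(x)T_{2(n-k-1)}(x),$$ $$F_{2n}(x)+F_{2n-2}(x) = xU_{2n-2}(x)-(3x^2-4)\sum_{k=1}^{n-1}F_{2k}(x)U_{2(n-k-1)}(x).$$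
   Context: The Chebyshev polynomials of the first kind $T_n(x)$ and of the second kind $U_n(x)$ are defined by $T_0(x)=1$, $T_1(x)=x$, $T_{n+1}(x)=2xT_n(x)-T_{n-1}(x)$, and $U_0(x)=1$, $U_1(x)=2x$, $U_{n+1}(x)=2xU_n(x)-U_{n-1}(x)$ for $n\ge 1$. The (Catalan) Fibonacci polynomials $F_n(x)$ are defined by $F_0(x)=0$, $F_1(x)=1$, $F_n(x)=xF_{n-1}(x)+F_{n-2}(x)$ for $n\geq 2$. A sum whose upper limit is smaller than its lower limit is $0$. *)

(* Defs.v *)
From mathcomp Require Import all_boot all_order all_algebra.
Set Implicit Arguments.
Unset Strict Implicit.
Unset Printing Implicit Defensive.
Import GRing.Theory.
Local Open Scope ring_scope.

Fixpoint chebT (n : nat) : {poly int} :=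
  match n with
  | 0 => 1
  | 1 => 'X
  | (m.+1 as p).+1 => 2 * 'X * chebT p - chebT m
  end.

Fixpoint chebU (n : nat) : {poly int} :=
  match n with
  | 0 => 1
  | 1 => 2 * 'X
  | (m.+1 as p).+1 => 2 * 'X * chebU p - chebU m
  end.

(* The (Catalan) Fibonacci polynomials, of degree n - 1. *)
Fixpoint fibp (n : nat) : {poly int} :=
  match n with
  | 0 => 0
  | 1 => 1
  | (m.+1 as p).+1 => 'X * fibp p + fibp m
  end.

(* Main.v *)
(* Along indices of a fixed parity, F satisfies a_(k+2) = p a_(k+1) - a_k with
   p = x^2 + 2, while T and U satisfy b_(k+2) = q b_(k+1) - b_k with
   q = 4x^2 - 2, and q - p = 3x^2 - 4.  Replacing q b_j by b_(j+1) + b_(j-1) and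
   p a_k by a_(k+1) + a_(k-1) makes (q - p) times the convolution of a and b
   telescope to boundary terms, and these are the remaining terms of the four
   identities. *)
Require Import Defs.
From mathcomp Require Import all_boot all_order all_algebra.
From mathcomp Require Import ring zify.
Set Implicit Arguments.
Unset Strict Implicit.
Unset Printing Implicit Defensive.
Import GRing.Theory.
Local Open Scope ring_scope.

(* [p * a 0 - a 1] and [q * b 0 - b 1] stand for the terms of index -1. *)
Lemma conv_order2_rec (R : comPzRingType) (p q : R) (a b : nat -> R) (m : nat) :
    (forall k, a k.+2 = p * a k.+1 - a k) ->
    (forall k, b k.+2 = q * b k.+1 - b k) ->
  (q - p) * \sum_(0 <= k < m.+1) a k * b (m - k)%N
    = a 0 * b m.+1 - a m.+1 * b 0
      + a m * (q * b 0 - b 1) - (p * a 0 - a 1) * b m.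
Proof.
(* The induction generalizes [a], not [b]: once the term [k = 0] is split off, what remains is the
   convolution of length [m.+1] for the shifted sequence [a k.+1]. *)
move=> a_rec b_rec; elim: m a a_rec => [|m IHm] a a_rec.
  by rewrite big_nat1; ring.
rewrite big_nat_recl //= mulrDr.
under eq_bigr => k _ do rewrite subSS.
rewrite (IHm (fun k => a k.+1)) // subn0 !a_rec !b_rec; ring.
Qed.

(** Squaring characteristic roots of sum [c] and product [- s] gives roots of sum [c ^+ 2 + 2 * s]
    and product [s ^+ 2 = 1]. Fibonacci has [s = 1], Chebyshev [s = -1]. *)
Lemma order2_rec_step2 (R : comPzRingType) (c s : R) (u : nat -> R) :
    s ^+ 2 = 1 -> (forall k, u k.+2 = c * u k.+1 + s * u k) ->
  forall k, u k.+4 = (c ^+ 2 + 2 * s) * u k.+2 - u k.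
Proof.
move=> s2 u_rec k.
have -> : u k = s ^+ 2 * u k by rewrite s2 mul1r.
by rewrite !u_rec; ring.
Qed.

Lemma fibp_step2 k : fibp k.+4 = ('X^2 + 2) * fibp k.+2 - fibp k.
Proof.
rewrite (@order2_rec_step2 _ 'X 1 fibp) ?expr1n ?mulr1 // => i.
by rewrite mul1r.
Qed.

Lemma chebT_step2 k : chebT k.+4 = (4 * 'X^2 - 2) * chebT k.+2 - chebT k.
Proof.
rewrite (@order2_rec_step2 _ (2 * 'X) (-1) chebT) ?sqrrN ?expr1n //.
  by ring.
by move=> i; rewrite mulN1r.
Qed.

Lemma chebU_step2 k : chebU k.+4 = (4 * 'X^2 - 2) * chebU k.+2 - chebU k.
Proof.
rewrite (@order2_rec_step2 _ (2 * 'X) (-1) chebU) ?sqrrN ?expr1n //.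
  by ring.
by move=> i; rewrite mulN1r.
Qed.

Lemma conv_fibp (u : nat -> {poly int}) (d e m : nat) :
    (forall k, u k.+4 = (4 * 'X^2 - 2) * u k.+2 - u k) ->
  (3 * 'X^2 - 4)
      * \sum_(0 <= k < m.+1) fibp (2 * k + d) * u (2 * (m - k) + e)%N
    = fibp d * u (2 * m + e).+2%N - fibp (2 * m + d).+2 * u e
      + fibp (2 * m + d) * ((4 * 'X^2 - 2) * u e - u e.+2)
      - (('X^2 + 2) * fibp d - fibp d.+2) * u (2 * m + e)%N.
Proof.
move=> u_step2.
have double1 (d' k : nat) : (2 * k.+1 + d' = (2 * k + d').+2)%N by lia.
have double2 (d' k : nat) : (2 * k.+2 + d' = (2 * k + d').+4)%N by lia.
have -> : 3 * 'X^2 - 4 = (4 * 'X^2 - 2) - ('X^2 + 2) :> {poly int} by ring.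
rewrite (@conv_order2_rec _ _ _ (fun k => fibp (2 * k + d))
  (fun k => u (2 * k + e)%N)) => [|k|k].
- by rewrite !double1 !muln0 !add0n.
- by rewrite double2 double1 fibp_step2.
- by rewrite double2 double1 u_step2.
Qed.

(** The first two boundary terms have coefficients F_1 = 1 and F_{-1} = (x^2 + 2) F_1 - F_3 = 1. *)
Lemma conv_fibp_odd (u : nat -> {poly int}) (m : nat) :
    (forall k, u k.+4 = (4 * 'X^2 - 2) * u k.+2 - u k) ->
  (3 * 'X^2 - 4)
      * \sum_(0 <= k < m.+1) fibp (2 * k + 1) * u (2 * (m.+1 - k) - 1)%N
    = u (2 * m).+3%N - u (2 * m).+1%N
      - fibp (2 * m).+3 * u 1
      + fibp (2 * m).+1 * ((4 * 'X^2 - 2) * u 1 - u 3).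
Proof.
(* The bound on [k] is needed: at [k = m.+1] truncated subtraction would break the index
   identity. *)
move=> u_step2; under eq_big_nat => k /andP[_ lt_k].
  have -> : (2 * (m.+1 - k) - 1 = 2 * (m - k) + 1)%N by lia.
  over.
by rewrite (conv_fibp _ _ _ u_step2) !addn1 [fibp 3]/= [fibp 1]/=; ring.
Qed.

(** The sum may start at 1 because F_0 = 0; the term in ['X] comes from F_{-2} = -F_2 = -x. *)
Lemma conv_fibp_even (u : nat -> {poly int}) (m : nat) :
    (forall k, u k.+4 = (4 * 'X^2 - 2) * u k.+2 - u k) ->
  (3 * 'X^2 - 4)
      * \sum_(1 <= k < m.+1) fibp (2 * k) * u (2 * (m.+1 - k - 1))%N
    = 'X * u (2 * m)%N - fibp (2 * m).+2 * u 0
      + fibp (2 * m) * ((4 * 'X^2 - 2) * u 0 - u 2).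
Proof.
move=> u_step2; have := conv_fibp 0 0 m u_step2.
rewrite big_ltn // muln0 [fibp (0 + 0)]/= mul0r add0r => conv.
under eq_bigr => k _.
  rewrite subnAC subn1 /= -[(2 * k)%N]addn0 -[(2 * (m - k))%N]addn0.
  over.
by rewrite conv !addn0 [fibp 2]/=; ring.
Qed.

Theorem theorem2 (n : nat) (hn : (1 <= n)%N) :
  [/\ 'X * (fibp (2 * n + 1) - fibp (2 * n - 1))
        = chebT (2 * n + 1) - chebT (2 * n - 1)
          - (3 * 'X^2 - 4)
            * \sum_(0 <= k < n) fibp (2 * k + 1) * chebT (2 * (n - k) - 1),
      2 * 'X * fibp (2 * n + 1)
        = chebU (2 * n + 1) - chebU (2 * n - 1)
          - (3 * 'X^2 - 4)
            * \sum_(0 <= k < n) fibp (2 * k + 1) * chebU (2 * (n - k) - 1),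
      fibp (2 * n) - (2 * 'X^2 - 1) * fibp (2 * n - 2)
        = 'X * chebT (2 * n - 2)
          - (3 * 'X^2 - 4)
            * \sum_(1 <= k < n) fibp (2 * k) * chebT (2 * (n - k - 1))
    & fibp (2 * n) + fibp (2 * n - 2)
        = 'X * chebU (2 * n - 2)
          - (3 * 'X^2 - 4)
            * \sum_(1 <= k < n) fibp (2 * k) * chebU (2 * (n - k - 1))].
Proof.
case: n hn => // m _.
have -> : (2 * m.+1 + 1 = (2 * m).+3)%N by lia.
have -> : (2 * m.+1 - 1 = (2 * m).+1)%N by lia.
have -> : (2 * m.+1 - 2 = 2 * m)%N by lia.
rewrite (conv_fibp_odd _ chebT_step2) (conv_fibp_odd _ chebU_step2).
rewrite (conv_fibp_even _ chebT_step2) (conv_fibp_even _ chebU_step2).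
have -> : (2 * m.+1 = (2 * m).+2)%N by lia.
(* Simplification evaluates the backward terms: T_{-1} = x, U_{-1} = 0, T_{-2} = 2x^2 - 1, U_{-2} =
   -1. They account for the different left-hand sides. *)
by split=> /=; ring.
Qed.
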